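(* Let $({\bf r}(t),\delta(t))$ be any solution of parallel navigation. Then the curve ${\bf r}$ can be reparametrized so that it satisfies $F({\bf r}(t),{\bf v}(t),\delta(t))=1$ for all $t$, where ${\bf v}=\dot{\bf r}$ and $$F({\bf r},{\bf v},\delta)=\frac{|{\bf v}|^2}{v_M\cos\delta\,|{\bf v}|-\langle{\bf v},{\bf v}_T\rangle}.$$
   Context: Setting. The ambient space is $\mathbb{R}^2$ or $\mathbb{R}^3$ with inner product $\langle\cdot,\cdot\rangle$ and norm $|\cdot|$. A pursuer $M$ and a target $T$ have positions ${\bf r}_M,{\bf r}_T$ in an inertial frame and velocities ${\bf v}_M=\dot{\bf r}_M$, ${\bf v}_T=\dot{\bf r}_T$, with speeds $v_M=|{\bf v}_M|$, $v_T=|{\bf v}_T|$, supposed constant. The range is ${\bf r}={\bf r}_T-{\bf r}_M$, the relative velocity is ${\bf v}=\dot{\bf r}={\bf v}_T-{\bf v}_M$, and $r=|{\bf r}|$. The velocity ${\bf v}_T$ is regarded as known at every ${\bf r}$ (a vector field). The line of sight (LOS) is the ray from $M$ towards $T$ (along ${\bf r}$); $\delta$ is the angle between ${\bf v}_M$ and the LOS (the control), $\theta$ is the angle between ${\bf v}_T$ and the LOS, and $\lambda$ is the angle between the LOS and the horizontal reference axis (angles in the plane are measured counterclockwise). Parallel navigation. The rule of parallel navigation (P-navigation) is that the direction of the LOS stays constant: ${\bf r}\times\dot{\bf r}=0$ (in the planar case $\dot\lambda=0$), together with the approach requirement $\langle{\bf r},{\bf v}\rangle<0$ (so $\dot r<0$,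 i.e. $v_T\cos\theta<v_M\cos\delta$). A solution of P-navigation is a curve $({\bf r}(t),\delta(t))$ obeying this rule and satisfying the kinematic equations $$\dot r=v_T\cos\theta-v_M\cos\delta,\qquad r\dot\lambda=v_T\sin\theta-v_M\sin\delta .$$ *)

(* Defs.v *)
From HB Require Import structures.
From mathcomp Require Import all_boot all_order all_algebra.
From mathcomp Require Import all_classical all_reals all_analysis.

Set Implicit Arguments.
Unset Strict Implicit.
Unset Printing Implicit Defensive.

Import Order.TTheory GRing.Theory Num.Theory.
Import numFieldNormedType.Exports.

Local Open Scope classical_set_scope.
Local Open Scope ring_scope.

Section Euclidean.
Variable R : realType.

Definition dot n (u v : 'rV[R]_n) : R := \sum_(i < n) u 0 i * v 0 i.

(* The library norm `|u| on row vectors is the sup norm, hence this one. *)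
Definition enorm n (u : 'rV[R]_n) : R := Num.sqrt (dot u u).

Definition cross2 (u v : 'rV[R]_2) : R := u 0 0 * v 0 1 - u 0 1 * v 0 0.

(* The indices live in 'I_3 and are added modulo 3. *)
Definition cross3 (u v : 'rV[R]_3) : 'rV[R]_3 :=
  \row_(k < 3) (u 0 (k + 1) * v 0 (k + 2%:R) - u 0 (k + 2%:R) * v 0 (k + 1)).

(* Oriented angle, counterclockwise from u to v, not reduced modulo 2 pi. *)
Definition is_angle2 (u v : 'rV[R]_2) (a : R) : Prop :=
  dot u v = enorm u * enorm v * cos a /\ cross2 u v = enorm u * enorm v * sin a.

(* Unoriented angle: space carries no counterclockwise sense. *)
Definition is_angle3 (u v : 'rV[R]_3) (a : R) : Prop :=
  0 <= a <= pi /\ dot u v = enorm u * enorm v * cos a.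

End Euclidean.

Section ParallelNavigation.
Variables (R : realType) (n : nat).

(* cross_zero u v stands for "u x v = 0" and is_angle u v a for "a is the angle
   from u to v"; pnav2 and pnav3 below fill them in for the plane and for space.
   VT is the field giving the target velocity at each value of the range vector,
   and vM, vT are the constant speeds.  The horizontal reference axis is spanned
   by delta_mx 0 0, the first vector of the canonical basis. *)
Variables (cross_zero : 'rV[R]_n.+1 -> 'rV[R]_n.+1 -> Prop)
  (is_angle : 'rV[R]_n.+1 -> 'rV[R]_n.+1 -> R -> Prop).
Variables (VT : 'rV[R]_n.+1 -> 'rV[R]_n.+1) (vM vT : R) (I : set R).

Record engagement (rM rT r : R -> 'rV[R]_n.+1) (delta theta lambda : R -> R)
    (t : R) : Prop := {
  range_def : r t = rT t - rM t ;
  pursuer_derivable : derivable rM t 1 ;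
  target_derivable : derivable rT t 1 ;
  range_derivable : derivable r t 1 ;
  target_velocity : derive1 rT t = VT (r t) ;
  pursuer_speed : enorm (derive1 rM t) = vM ;
  target_speed : enorm (derive1 rT t) = vT ;
  delta_angle : is_angle (r t) (derive1 rM t) (delta t) ;
  theta_angle : is_angle (r t) (derive1 rT t) (theta t) ;
  lambda_angle : is_angle (delta_mx 0 0) (r t) (lambda t) ;
  radial_equation :
    is_derive t (1 : R) (fun s => enorm (r s))
      (vT * cos (theta t) - vM * cos (delta t)) ;
  lambda_derivable : derivable lambda t 1 ;
  transverse_equation :
    enorm (r t) * derive1 lambda t = vT * sin (theta t) - vM * sin (delta t)
}.

Definition pnav_rule (r : R -> 'rV[R]_n.+1) (t : R) : Prop :=
  cross_zero (r t) (derive1 r t) /\ dot (r t) (derive1 r t) < 0.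

Definition pnav (r : R -> 'rV[R]_n.+1) (delta : R -> R) : Prop :=
  exists (rM rT : R -> 'rV[R]_n.+1) (theta lambda : R -> R),
    forall t, I t ->
      engagement rM rT r delta theta lambda t /\ pnav_rule r t.

Definition navF (r v : 'rV[R]_n.+1) (delta : R) : R :=
  enorm v ^+ 2 / (vM * cos delta * enorm v - dot v (VT r)).

End ParallelNavigation.

Definition pnav2 (R : realType) :=
  @pnav R 1 (fun u v => cross2 u v = 0) (@is_angle2 R).

Definition pnav3 (R : realType) :=
  @pnav R 2 (fun u v => cross3 u v = 0) (@is_angle3 R).

Definition open_interval (R : realType) (I : set R) : Prop :=
  open I /\ is_interval I.

(* C^1 change of parameter from J onto I with nowhere vanishing derivative; like
   any diffeomorphism of intervals it may reverse the orientation. *)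
Definition reparametrization (R : realType) (J I : set R) (phi : R -> R) : Prop :=
  [/\ open_interval J, set_bij J I phi &
      forall s, J s ->
        [/\ derivable phi s 1, {for s, continuous (derive1 phi)} &
            derive1 phi s != 0]].

Definition reparametrizes_to_unit (R : realType) (n : nat)
    (VT : 'rV[R]_n.+1 -> 'rV[R]_n.+1) (vM : R) (I : set R)
    (r : R -> 'rV[R]_n.+1) (delta : R -> R) : Prop :=
  exists (J : set R) (phi : R -> R),
    reparametrization J I phi /\
    forall s, J s ->
      navF VT vM ((r \o phi) s) (derive1 (r \o phi) s) ((delta \o phi) s) = 1.

(* Main.v *)
(** If r' is antiparallel to r then r' = -(|r'| / |r|) r, and expanding
    |r'|^2 = <r', v_T - v_M> gives |r'|^2 = v_M cos(delta) |r'| + <r', v_T>.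
    This differs from the equation F = 1 only in the sign of <r', v_T>, so
    reversing time, t = -s, turns the curve into one on which F = 1. *)
Require Import Defs.
From HB Require Import structures.
From mathcomp Require Import all_boot all_order all_algebra.
From mathcomp Require Import all_classical all_reals all_analysis.
From mathcomp Require Import ring.

Import Order.TTheory GRing.Theory Num.Theory.
Import numFieldNormedType.Exports.

Local Open Scope classical_set_scope.
Local Open Scope ring_scope.

Section EuclideanTheory.
Context {R : realType} {n : nat}.
Implicit Types u v w : 'rV[R]_n.

Lemma dotC u v : dot u v = dot v u.
Proof. by apply: eq_bigr => i _; rewrite mulrC. Qed.

Lemma dotDr u v w : dot u (v + w) = dot u v + dot u w.
Proof. by rewrite /dot -big_split; apply: eq_bigr => i _; rewrite mxE mulrDr. Qed.

Lemma dotZr a u v : dot u (a *: v) = a * dot u v.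
Proof. by rewrite /dot mulr_sumr; apply: eq_bigr => i _; rewrite mxE mulrCA. Qed.

Lemma dotNr u v : dot u (- v) = - dot u v.
Proof. by rewrite -scaleN1r dotZr mulN1r. Qed.

Lemma dotNl u v : dot (- u) v = - dot u v.
Proof. by rewrite dotC dotNr dotC. Qed.

Lemma dot_ge0 u : 0 <= dot u u.
Proof. by apply: sumr_ge0 => i _; rewrite -expr2 sqr_ge0. Qed.

Lemma enorm_ge0 u : 0 <= enorm u.
Proof. exact: sqrtr_ge0. Qed.

Lemma enorm_sqr u : enorm u ^+ 2 = dot u u.
Proof. by rewrite sqr_sqrtr ?dot_ge0. Qed.

Lemma enormN u : enorm (- u) = enorm u.
Proof. by rewrite /enorm dotNl dotNr opprK. Qed.

Lemma enorm_eq0_dot u v : enorm u = 0 -> dot u v = 0.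
Proof.
move=> u0; have := enorm_sqr u; rewrite u0 expr0n /= => /esym/eqP.
rewrite /dot psumr_eq0 => [/allP u0i|i _]; last by rewrite -expr2 sqr_ge0.
apply: big1 => i _; have := u0i i (mem_index_enum _).
by rewrite /= mulf_eq0 orbb => /eqP ->; rewrite mul0r.
Qed.

(** Vanishing of all 2x2 minors: a form free of division that makes sense in every dimension and to
    which both cross products reduce. *)
Definition collinear u v := forall i j, u 0 i * v 0 j = u 0 j * v 0 i.

(** Multiply [u_i v_j = u_j v_i] by [u_i w_j] and sum over [i] and [j]. *)
Lemma collinear_dot u v w :
  collinear u v -> dot u u * dot v w = dot u v * dot u w.
Proof.
move=> uv; rewrite /dot !mulr_suml; apply: eq_bigr => i _.
rewrite !mulr_sumr; apply: eq_bigr => j _.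
transitivity (u 0 i * (u 0 i * v 0 j) * w 0 j); first by ring.
by rewrite uv; ring.
Qed.

(** This is [v = -(|v| / |u|) u] tested against [w], with the denominator cleared. *)
Lemma antiparallel_dot u v w : collinear u v -> dot u v < 0 ->
  enorm u * dot v w = - (enorm v * dot u w).
Proof.
move=> uv uv0.
have u0 : enorm u != 0.
  by apply: contraTneq uv0 => /enorm_eq0_dot->; rewrite ltxx.
have duv : dot u v = - (enorm u * enorm v).
  (* Collinearity gives the equality case of Cauchy-Schwarz; the negative sign of [dot u v] then
     selects the root. *)
  have : dot u v ^+ 2 = (enorm u * enorm v) ^+ 2.
    by rewrite exprMn !enorm_sqr (collinear_dot _ _ v uv) expr2.
  move/eqP; rewrite eqf_sqr => /orP[|]/eqP// duv.
  by move: uv0; rewrite duv ltNge mulr_ge0 ?enorm_ge0.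
apply: (mulfI u0); rewrite mulrA -expr2 enorm_sqr (collinear_dot _ _ w uv) duv.
by ring.
Qed.

End EuclideanTheory.

Lemma cross2_collinear (R : realType) (u v : 'rV[R]_2) :
  cross2 u v = 0 -> collinear u v.
Proof.
move=> /eqP; rewrite subr_eq0 => /eqP uv i j.
have ord2 (k : 'I_2) : k = 0 \/ k = 1.
  by case: k => -[|[|//]] lt_k; [left|right]; apply: val_inj.
by case: (ord2 i) => ->; case: (ord2 j) => ->.
Qed.

(** Coordinate [k] of the cross product is the minor on the indices [k + 1] and [k + 2]; modulo 3
    these run through all pairs of distinct indices. *)
Lemma cross3_collinear (R : realType) (u v : 'rV[R]_3) :
  cross3 u v = 0 -> collinear u v.
Proof.
move=> uv.
have uvk (k : 'I_3) : u 0 (k + 1) * v 0 (k + 2%:R) = u 0 (k + 2%:R) * v 0 (k + 1).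
  by apply/eqP; rewrite -subr_eq0; move/rowP/(_ k): uv; rewrite !mxE => ->.
move=> i j; have : j \in [:: i; i + 1; i + 2%:R].
  by case: i j => -[|[|[|//]]] ? [[|[|[|//]]] ?].
rewrite !inE => /or3P[]/eqP-> //.
(* The coordinate to use is the index missing from the pair: [i + 2] for [j = i + 1], and [i + 1]
   for [j = i + 2]. *)
- have := uvk (i + 2%:R); have -> : i + 2%:R + 1 = i.
    by apply: val_inj; case: i => -[|[|[|]]].
  by have -> : i + 2%:R + 2%:R = i + 1 by apply: val_inj; case: i => -[|[|[|]]].
- have := uvk (i + 1); have -> : i + 1 + 1 = i + 2%:R.
    by apply: val_inj; case: i => -[|[|[|]]].
  by have -> : i + 1 + 2%:R = i by apply: val_inj; case: i => -[|[|[|]]].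
Qed.

Section TimeReversal.
Context {R : realType}.

Lemma is_derive_comp_opp {V : normedModType R} (f : R -> V) (t : R) :
  derivable f (- t) 1 -> is_derive t (1 : R) (f \o -%R) (- derive1 f (- t)).
Proof.
move=> /derivable1_diffP df.
have dopp : differentiable (-%R : R -> R) t by apply/derivable1_diffP.
have dc : differentiable (f \o -%R) t by exact: differentiable_comp.
apply: DeriveDef; first exact/derivable1_diffP.
by rewrite deriveE // diff_comp //= (diff1E df) -deriveE // derive_val scaleN1r.
Qed.

Lemma reparametrization_opp (I : set R) :
  open_interval I -> reparametrization (-%R @^-1` I) I -%R.
Proof.
case=> oI iI.
have d1 : derive1 (-%R : R -> R) = cst (- 1).
  by apply/funext => s; rewrite derive1E derive_val.
split; first split.
- by apply: open_comp => // s _; exact: opp_continuous.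
(* Negation reverses the order, so the endpoints are swapped. *)
- move=> x y Ix Iy z /andP[xz zy]; apply: (iI _ _ Iy Ix).
  by rewrite !lerN2 zy xz.
- split=> [s //|s t _ _ /oppr_inj //|t It].
  by exists (- t); rewrite /= opprK.
- move=> s _; split=> //; rewrite d1; first exact: cst_continuous.
  by rewrite oppr_eq0 oner_eq0.
Qed.

End TimeReversal.

Section Reversal.
Context {R : realType} {n : nat}.
Variables (cross_zero : 'rV[R]_n.+1 -> 'rV[R]_n.+1 -> Prop)
  (is_angle : 'rV[R]_n.+1 -> 'rV[R]_n.+1 -> R -> Prop).
(** Interface common to the plane and to space, so that the argument is run once for both. *)
Hypothesis cross_collinear : forall u v, cross_zero u v -> collinear u v.
Hypothesis is_angle_dot :
  forall u v a, is_angle u v a -> dot u v = enorm u * enorm v * cos a.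
Variables (VT : 'rV[R]_n.+1 -> 'rV[R]_n.+1) (vM vT : R) (I : set R).
Hypothesis hI : open_interval I.
Variables (r : R -> 'rV[R]_n.+1) (delta : R -> R).
Hypothesis sol : pnav cross_zero is_angle VT vM vT I r delta.

Lemma pnav_speed_sqr t : I t ->
  enorm (derive1 r t) ^+ 2 =
    vM * cos (delta t) * enorm (derive1 r t) + dot (derive1 r t) (VT (r t)).
Proof.
case: sol => rM [rT [theta [lambda eng]]] It.
have [e [/cross_collinear col app]] := eng t It.
have dr : derive1 r t = VT (r t) - derive1 rM t.
  rewrite -(target_velocity e) !derive1E -deriveB; last 2 first.
  - exact: target_derivable e.
  - exact: pursuer_derivable e.
  (* The relation [r = rT - rM] is given on [I] only; as [I] is open it holds near [t], which
     suffices for derivatives. *)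
  apply: near_eq_derive.
  have : \forall s \near t, I s by apply: open_nbhs_nbhs; split=> //; case: hI.
  by apply: filterS => s Is; have [/range_def] := eng s Is.
have r0 : enorm (r t) != 0.
  by apply: contraTneq app => /enorm_eq0_dot->; rewrite ltxx.
(* The angle [delta t] is measured from [r t], to which the relative velocity is opposite; hence the
   minus sign in [dM] once [|r|] is cancelled. *)
have := antiparallel_dot _ _ (derive1 rM t) col app.
rewrite (is_angle_dot _ _ _ (delta_angle e)) (pursuer_speed e) => rdM.
have dM : dot (derive1 r t) (derive1 rM t)
    = - (vM * cos (delta t) * enorm (derive1 r t)).
  by apply: (mulfI r0); rewrite rdM; ring.
by rewrite enorm_sqr {2}dr dotDr dotNr dM opprK addrC.
Qed.

Lemma pnav_reparametrizes_to_unit : reparametrizes_to_unit VT vM I r delta.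
Proof.
exists (-%R @^-1` I), -%R; split; first exact: reparametrization_opp.
move=> s Is; have Es := pnav_speed_sqr _ Is.
case: sol => rM [rT [theta [lambda eng]]].
have [e [_ app]] := eng _ Is.
(* By [Es] the denominator of [navF] along the reversed curve is [|r'|^2], so the quotient is 1 only
   if [r'] is nonzero; division by zero would yield 0. *)
have v0 : enorm (derive1 r (- s)) != 0.
  by apply: contraTneq app => /enorm_eq0_dot d0; rewrite dotC d0 ltxx.
have -> : derive1 (r \o -%R) s = - derive1 r (- s).
  have dr := is_derive_comp_opp _ _ (range_derivable e).
  by rewrite derive1E derive_val.
by rewrite /navF /= enormN dotNl opprK -Es divff // expf_neq0.
Qed.

End Reversal.

Theorem theorem1p1 (R : realType) (vM vT : R) (I : set R) (hI : open_interval I)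
    (delta : R -> R) :
  (forall (VT : 'rV[R]_2 -> 'rV[R]_2) (r : R -> 'rV[R]_2),
      pnav2 VT vM vT I r delta -> reparametrizes_to_unit VT vM I r delta) /\
  (forall (VT : 'rV[R]_3 -> 'rV[R]_3) (r : R -> 'rV[R]_3),
      pnav3 VT vM vT I r delta -> reparametrizes_to_unit VT vM I r delta).
Proof.
split=> VT r sol; apply: pnav_reparametrizes_to_unit sol => //.
- exact: cross2_collinear.
- by move=> u v a [].
- exact: cross3_collinear.
- by move=> u v a [].
Qed.
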